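(* Suppose that one has a pushout square of flows $$\begin{array}{ccc}\mathrm{Glob}(P) & \xrightarrow{\ \phi\ } & A\\ \downarrow & & \downarrow f\\ \mathrm{Glob}(Q) & \longrightarrow & X\end{array}$$ where the left vertical map is $\mathrm{Glob}$ applied to a continuous map $P\to Q$ which is an inclusion of a deformation retract of topological spaces. Then the continuous map $\mathbb{P}f:\mathbb{P}A\to\mathbb{P}X$ is a weak homotopy equivalence.
   Context: $\mathbf{Top}$ is the category of compactly generated spaces (weak Hausdorff $k$-spaces) and continuous maps; all spaces are in $\mathbf{Top}$, and products and limits are taken in $\mathbf{Top}$. A flow $X$ consists of a space $\mathbb{P}X$ (path space), a discrete space $X^0$ ($0$-skeleton), continuous maps $s,t:\mathbb{P}X\to X^0$, and a continuous associative map $*:\{(x,y)\in \mathbb{P}X\times\mathbb{P}X;\ t(x)=s(y)\}\to\mathbb{P}X$ with $s(x*y)=s(x)$, $t(x*y)=t(y)$ (no identities are required). A morphism of flows $f:X\to Y$ is a set map $f^0:X^0\to Y^0$ together with a continuous map $\mathbb{P}f:\mathbb{P}X\to\mathbb{P}Y$ commuting with $s$, $t$ and $*$. The category of flows is complete and cocomplete; the pushout is taken in it. For a space $Z$, $\mathrm{Glob}(Z)$ is the flow with $\mathrm{Glob}(Z)^0=\{0,1\}$, $\mathbb{P}\,\mathrm{Glob}(Z)=Z$, $s=0$, $t=1$; $\mathrm{Glob}$ is a functor. A continuous map $i:P\to Q$ is an inclusion of a deformation retract if there are a continuous map $r:Q\to P$ with $r\circ i=\mathrm{Id}_P$ and a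 homotopy $K:[0,1]\times Q\to Q$ with $K(0,q)=q$, $K(1,q)=i(r(q))$ and $K(t,i(p))=i(p)$ for all $t,p,q$. *)

(* Defs.v *)
From HB Require Import structures.
From mathcomp Require Import all_boot all_order all_algebra.
From mathcomp Require Import all_classical all_reals topology.

Set Implicit Arguments.
Unset Strict Implicit.
Unset Printing Implicit Defensive.

Import Order.TTheory GRing.Theory Num.Theory.
Import numFieldTopology.Exports.

Local Open Scope classical_set_scope.
Local Open Scope ring_scope.

Definition compact_hausdorff (K : topologicalType) : Prop :=
  compact [set: K] /\ hausdorff_space K.

Definition k_space (T : topologicalType) : Prop :=
  forall A : set T,
    (forall (K : topologicalType) (u : continuousType K T),
       compact_hausdorff K -> closed (u @^-1` A)) ->
    closed A.

Definition weak_hausdorff (T : topologicalType) : Prop :=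
  forall (K : topologicalType) (u : continuousType K T),
    compact_hausdorff K -> closed (range u).

HB.mixin Record isCompactlyGenerated T & Topological T := {
  k_spaceP : k_space T;
  weak_hausdorffP : weak_hausdorff T;
}.

#[short(type="cgType")]
HB.structure Definition CompactlyGenerated :=
  {T of Topological T & isCompactlyGenerated T}.

(* A limit of compactly generated spaces is the k-ification of the limit
   computed in all topological spaces. *)
Definition kify (T : Type) : Type := T.

Section Kify.
Variable T : topologicalType.

Definition k_open : set (set (kify T)) :=
  [set A | forall (K : topologicalType) (u : continuousType K T),
     compact_hausdorff K -> open (u @^-1` A)].

Local Lemma k_openT : k_open [set: kify T].
Proof. by move=> K u _; rewrite preimage_setT; exact: openT. Qed.

Local Lemma k_openI : setI_closed k_open.
Proof.
by move=> A B oA oB K u hK; rewrite preimage_setI; apply: openI;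
  [exact: oA | exact: oB].
Qed.

Local Lemma k_open_bigU (I : Type) (F : I -> set (kify T)) :
  (forall i, k_open (F i)) -> k_open (\bigcup_i F i).
Proof.
move=> oF K u hK; rewrite preimage_bigcup.
by apply: bigcup_open => i _; exact: oF.
Qed.

HB.instance Definition _ := Choice.on (kify T).
HB.instance Definition _ :=
  isOpenTopological.Build (kify T) k_openT k_openI k_open_bigU.

End Kify.

Definition composable (P S : topologicalType) (s t : P -> S) :
    topologicalType :=
  kify (set_type [set xy : P * P | t xy.1 = s xy.2]).

Definition cpair (P S : topologicalType) (s t : P -> S) (x y : P)
    (h : t x = s y) : composable s t :=
  exist _ (x, y)
    (mem_set (h : [set xy : P * P | t xy.1 = s xy.2] (x, y))).

Record flow := Flow {
  skel : discreteTopologicalType;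
  pathsp : cgType;
  src : continuousType pathsp skel;
  tgt : continuousType pathsp skel;
  concat : continuousType (composable src tgt) pathsp;
  src_concat : forall (x y : pathsp) (h : tgt x = src y),
    src (concat (cpair h)) = src x;
  tgt_concat : forall (x y : pathsp) (h : tgt x = src y),
    tgt (concat (cpair h)) = tgt y;
  concatA : forall (x y z : pathsp)
    (hxy : tgt x = src y) (hyz : tgt y = src z)
    (hl : tgt (concat (cpair hxy)) = src z)
    (hr : tgt x = src (concat (cpair hyz))),
    concat (cpair hl) = concat (cpair hr);
}.

Arguments src {f}.
Arguments tgt {f}.
Arguments concat {f}.

Record flow_mor (X Y : flow) := FlowMor {
  mskel : skel X -> skel Y;
  mpath : continuousType (pathsp X) (pathsp Y);
  mor_src : forall x, src (mpath x) = mskel (src x);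
  mor_tgt : forall x, tgt (mpath x) = mskel (tgt x);
  mor_concat : forall (x y : pathsp X) (h : tgt x = src y)
    (h' : tgt (mpath x) = src (mpath y)),
    mpath (concat (cpair h)) = concat (cpair h');
}.

Section FlowComp.
Variables (X Y Z : flow) (g : flow_mor Y Z) (f : flow_mor X Y).

Let p : continuousType (pathsp X) (pathsp Z) := mpath g \o mpath f.

Local Lemma comp_src x : src (p x) = mskel g (mskel f (src x)).
Proof. by rewrite /p /= mor_src mor_src. Qed.

Local Lemma comp_tgt x : tgt (p x) = mskel g (mskel f (tgt x)).
Proof. by rewrite /p /= mor_tgt mor_tgt. Qed.

Local Lemma comp_concat (x y : pathsp X) (h : tgt x = src y)
  (h' : tgt (p x) = src (p y)) : p (concat (cpair h)) = concat (cpair h').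
Proof.
have h1 : tgt (mpath f x) = src (mpath f y) by rewrite mor_tgt h mor_src.
by rewrite /p /= (mor_concat h h1) (mor_concat h1 h').
Qed.

Definition flow_comp : flow_mor X Z :=
  @FlowMor X Z (mskel g \o mskel f) p comp_src comp_tgt comp_concat.

End FlowComp.

Definition is_pushout (B A C X : flow) (phi : flow_mor B A)
    (g : flow_mor B C) (f : flow_mor A X) (psi : flow_mor C X) : Prop :=
  flow_comp f phi = flow_comp psi g /\
  forall (Z : flow) (u : flow_mor A Z) (v : flow_mor C Z),
    flow_comp u phi = flow_comp v g ->
    exists! h : flow_mor X Z, flow_comp h f = u /\ flow_comp h psi = v.

(* Glob(Z): the states 0 and 1 are [false] and [true]; no two paths are
   composable. *)
Section Glob.
Variable Z : cgType.

Let gs : continuousType Z bool := cst false.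
Let gt : continuousType Z bool := cst true.

Definition glob_concat_fun (w : composable gs gt) : Z := (set_val w).1.

Local Lemma composable_glob (w : composable gs gt) : False.
Proof. by have := set_valP w. Qed.

Local Lemma glob_concat_continuous : continuous glob_concat_fun.
Proof. by move=> w; case: (composable_glob w). Qed.

Definition glob_concat : continuousType (composable gs gt) Z :=
  mkcts glob_concat_continuous.

Local Lemma glob_src_concat (x y : Z) (h : gt x = gs y) :
  gs (glob_concat (cpair h)) = gs x.
Proof. by []. Qed.

Local Lemma glob_tgt_concat (x y : Z) (h : gt x = gs y) :
  gt (glob_concat (cpair h)) = gt y.
Proof. by []. Qed.

Local Lemma glob_concatA (x y z : Z) (hxy : gt x = gs y) (hyz : gt y = gs z)
  (hl : gt (glob_concat (cpair hxy)) = gs z)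
  (hr : gt x = gs (glob_concat (cpair hyz))) :
  glob_concat (cpair hl) = glob_concat (cpair hr).
Proof. by []. Qed.

Definition Glob : flow :=
  @Flow bool Z gs gt glob_concat glob_src_concat glob_tgt_concat glob_concatA.

End Glob.

Section GlobMap.
Variables (P Q : cgType) (g : continuousType P Q).

Local Lemma globmap_concat (x y : pathsp (Glob P)) (h : tgt x = src y)
  (h' : @tgt (Glob Q) (g x) = @src (Glob Q) (g y)) :
  g (concat (cpair h)) = @concat (Glob Q) (cpair h').
Proof. by []. Qed.

Definition Glob_map : flow_mor (Glob P) (Glob Q) :=
  @FlowMor (Glob P) (Glob Q) idfun g
    (fun=> erefl) (fun=> erefl) globmap_concat.

End GlobMap.

Definition unitI (R : realType) : topologicalType :=
  set_type (`[0 : R, 1]%classic : set R).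

Section UnitInterval.
Variable R : realType.

Local Lemma unitI0_proof : (0 : R) \in (`[0 : R, 1]%classic : set R).
Proof. by rewrite inE /= in_itv /= lexx ler01. Qed.

Local Lemma unitI1_proof : (1 : R) \in (`[0 : R, 1]%classic : set R).
Proof. by rewrite inE /= in_itv /= lexx ler01. Qed.

Definition unitI0 : unitI R := exist _ 0 unitI0_proof.
Definition unitI1 : unitI R := exist _ 1 unitI1_proof.

End UnitInterval.
Arguments unitI0 {R}.
Arguments unitI1 {R}.

Definition deformation_retract_inclusion (R : realType) (P Q : cgType)
    (i : continuousType P Q) : Prop :=
  exists (r : continuousType Q P)
         (K : continuousType (kify (unitI R * Q)%type) Q),
    [/\ forall p, r (i p) = p,
        forall q, K (unitI0, q) = q,
        forall q, K (unitI1, q) = i (r q) &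
        forall t p, K (t, i p) = i p].

Section Pi0.
Variables (R : realType).

Definition pi0_class (X : topologicalType) (x : X) : set X :=
  [set y | exists c : continuousType (unitI R) X,
     c unitI0 = x /\ c unitI1 = y].

Definition pi0 (X : topologicalType) : set (set X) := range (@pi0_class X).

(* For C in [pi0 X] all members of C give the same class, so the union is
   that class; similarly for [pi_map] below. *)
Definition pi0_map (X Y : topologicalType) (f : continuousType X Y)
    (C : set X) : set Y :=
  \bigcup_(x in C) pi0_class (f x).

End Pi0.

Section HomotopyGroups.
Variables (R : realType) (n : nat).

Definition cube : topologicalType := prod_topology (fun _ : 'I_n => unitI R).

Definition cube_boundary : set cube :=
  [set t | exists i : 'I_n, t i = unitI0 \/ t i = unitI1].

Definition gloop (X : topologicalType) (x : X) : set (continuousType cube X) :=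
  [set a | forall t, cube_boundary t -> a t = x].

(* [0, 1] and the cube are compact Hausdorff, so their product needs no
   k-ification. *)
Definition gloop_homotopic (X : topologicalType) (x : X)
    (a b : continuousType cube X) : Prop :=
  exists H : continuousType (unitI R * cube)%type X,
    [/\ forall t, H (unitI0, t) = a t,
        forall t, H (unitI1, t) = b t &
        forall s t, cube_boundary t -> H (s, t) = x].

Definition pi_class (X : topologicalType) (x : X)
    (a : continuousType cube X) : set (continuousType cube X) :=
  [set b | gloop x b /\ gloop_homotopic x a b].

Definition pi_n (X : topologicalType) (x : X) :
    set (set (continuousType cube X)) :=
  [set pi_class x a | a in gloop x].

Definition pi_map (X Y : topologicalType) (f : continuousType X Y) (x : X)
    (C : set (continuousType cube X)) : set (continuousType cube Y) :=
  \bigcup_(a in C) pi_class (f x) (f \o a : continuousType cube Y).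

End HomotopyGroups.

(* For n >= 1 the map [pi_map] is a group morphism for the concatenation of
   loops, so it is an isomorphism of groups exactly when it is bijective. *)
Definition weak_homotopy_equivalence (R : realType) (X Y : topologicalType)
    (f : continuousType X Y) : Prop :=
  set_bij (@pi0 R X) (@pi0 R Y) (@pi0_map R X Y f) /\
  forall (n : nat) (x : X), (0 < n)%N ->
    set_bij (@pi_n R n X x) (@pi_n R n Y (f x)) (@pi_map R n X Y f x).

(* Main.v *)
From HB Require Import structures.
Require Import Defs.
From mathcomp Require Import all_boot all_order all_algebra.
From mathcomp Require Import all_classical all_reals topology.
From mathcomp Require Import normedtype.

(** The retraction of Q onto P and its homotopy are data of maps and homotopies
    out of Glob(Q), so they can be pushed along the square by the universal
    property alone; no description of the path space of X as a space of
    words is required.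

    The maps id : A -> A and phi o Glob(r) : Glob(Q) -> A agree on Glob(P) and
    induce h : X -> A with h o f = id. For the homotopy, let I be the unit
    interval and let X^I be the flow with the states of X and with path space
    the space Map(I, PX), composed pointwise (a path in Map(I, PX) has a
    well-defined source because I is connected and the states are discrete).
    A morphism B -> X^I is a homotopy of morphisms B -> X that is constant on
    states. The constant homotopy at f and the homotopy psi o K agree on
    Glob(P), because K is stationary on P; so they induce H : X -> X^I. By
    uniqueness in the universal property, H evaluated at 0 is id and H
    evaluated at 1 is f o h, while H o f is constant in time
    ([pushout_strong_deformation_retract]). Hence PA is a strong deformation
    retract of PX through Pf, and such an inclusion is bijective on path
    components and on all homotopy groups
    ([strong_deformation_retract_weak_equivalence]).

    The topological work is to show that X^I is a flow in the category of
    compactly generated spaces. Map(I, PX) is the k-ification of the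
    compact-open topology. It is weak Hausdorff because the evaluations
    separate its points ([weak_hausdorff_kify]). Continuity of maps into it is
    tested on compact Hausdorff spaces, where it becomes continuity of the
    uncurried map ([paths_curry_continuous], [paths_uncurry_continuous]). *)

Set Implicit Arguments.
Unset Strict Implicit.
Unset Printing Implicit Defensive.

Import Order.TTheory GRing.Theory Num.Theory.
Import numFieldNormedType.Exports.

Local Open Scope classical_set_scope.
Local Open Scope ring_scope.

(** * Compact Hausdorff spaces *)

Lemma cluster_continuous (T U : topologicalType) (f : T -> U) (p q : T) :
  continuous f -> hausdorff_space U -> cluster (nbhs p) q -> f p = f q.
Proof.
move=> cf hU pq; apply: hU => A B /cf fA /cf fB.
by have [x [Ax Bx]] := pq _ _ fA fB; exists (f x).
Qed.

Lemma compact_hausdorff_prod (K L : topologicalType) :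
  compact_hausdorff K -> compact_hausdorff L ->
  compact_hausdorff (K * L)%type.
Proof.
move=> [cK hK] [cL hL]; split; first by rewrite -setXTT; exact: compact_setX.
move=> p q pq; rewrite (surjective_pairing p) (surjective_pairing q).
congr (_, _).
- by apply: cluster_continuous pq => //; move=> x; exact: cvg_fst.
- by apply: cluster_continuous pq => //; move=> x; exact: cvg_snd.
Qed.

(** A retraction of the ambient space onto the subset (constant outside it, so
    continuous only within it) exhibits the subtype as an image of the subset,
    to which preservation of compactness applies. *)
Lemma compact_set_type (T : topologicalType) (A : set T) :
  compact A -> compact [set: set_type A].
Proof.
move=> cA; have [[a _]|nA] := pselect ([set: set_type A] !=set0); last first.
  suff -> : [set: set_type A] = set0 by exact: compact0.
  by apply/seteqP; split=> // a _; apply: nA; exists a.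
pose f (x : T) : set_type A := insubd a x.
have -> : [set: set_type A] = f @` A.
  apply/seteqP; split=> // x _; exists (set_val x); first exact: set_valP.
  by rewrite /f /insubd valK.
apply: continuous_compact => //; apply/subspace_sigL_continuousP.
suff -> : sigL A f = idfun by exact: cts_fun.
by apply/funext => x; rewrite /f /sigL /= /insubd valK.
Qed.

Lemma compact_hausdorff_set_type (T : topologicalType) (A : set T) :
  compact_hausdorff T -> closed A -> compact_hausdorff (set_type A).
Proof.
move=> [cT hT] clA; split.
  by apply: compact_set_type; apply: subclosed_compact cT _.
move=> p q pq; apply: val_inj.
by apply: cluster_continuous pq => //; exact: initial_continuous.
Qed.

(** * The k-ification *)

Lemma kify_openE (T : topologicalType) (A : set (kify T)) :
  open A = k_open A.
Proof. by []. Qed.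

Lemma kify_id_continuous (T : topologicalType) :
  continuous (id : kify T -> T).
Proof.
apply/continuousP => A oA; rewrite kify_openE => K u _.
by apply: open_comp => // x _; exact: cts_fun.
Qed.

Lemma continuous_to_kify (K T : topologicalType) (g : K -> T) :
  compact_hausdorff K -> continuous g -> continuous (g : K -> kify T).
Proof.
move=> hK cg; apply/continuousP => A; rewrite kify_openE.
by move=> /(_ _ (mkcts cg) hK).
Qed.

Lemma k_space_continuous (S T : topologicalType) (g : S -> T) : k_space S ->
  (forall (K : topologicalType) (u : continuousType K S),
     compact_hausdorff K -> continuous (g \o u)) -> continuous g.
Proof.
move=> kS gu; apply/continuous_closedP => A clA; apply: kS => K u hK.
rewrite -comp_preimage.
exact: (continuous_closedP (g \o u)).1 (gu _ _ hK) _ clA.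
Qed.

Lemma k_space_kify (T : topologicalType) : k_space (kify T).
Proof.
move=> A clA; rewrite -openC kify_openE => K u hK; rewrite preimage_setC openC.
exact: clA _ (mkcts (continuous_to_kify hK (@cts_fun _ _ u))) hK.
Qed.

(** * Weak Hausdorff spaces *)

(** Images of closed subsets of K are closed in Y, so the complements of the
    images of two closed sets covering K are open sets that do not meet inside
    the image of K. The two closed sets come from normality of K, applied to
    the fibres over the two points. Separating [u k] from an arbitrary point
    [y] of Y is what lets the next lemma compare maps from two sources. *)
Lemma weak_hausdorff_separated (K Y : topologicalType)
    (u : continuousType K Y) (k : K) (y : Y) :
  weak_hausdorff Y -> compact_hausdorff K -> u k <> y ->
  exists V W : set Y,
    [/\ open V, open W, V (u k), W y & V `&` W `&` range u = set0].
Proof.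
move=> wY hK uky; have [cK HK] := hK.
have cl1 (z : Y) : closed [set z].
  have -> : [set z] = range (cst z : K -> Y).
    by apply/seteqP; split=> [_ ->|_ [? _ <-]] //; exists k.
  exact: wY.
have clu (z : Y) : closed (u @^-1` [set z]).
  exact: (continuous_closedP u).1 (@cts_fun _ _ u) _ (cl1 z).
have clim C : closed C -> closed (u @` C).
  move=> clC; pose v := u \o (set_val : set_type C -> K).
  have cv : continuous v.
    move=> x; apply: continuous_comp; last exact: cts_fun.
    exact: initial_continuous.
  have -> : u @` C = range (mkcts cv).
    apply/seteqP; split=> [_ [x Cx <-]|_ [x _ <-]].
      by exists (exist _ x (mem_set Cx)).
    by exists (set_val x) => //; exact: set_valP.
  by apply: wY; exact: compact_hausdorff_set_type.
have nK := compact_normal HK cK.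
have [|B nB BC] := nK _ (clu (u k)) (~` (u @^-1` [set y])).
  move=> x uxk; apply: open_nbhs_nbhs; split; first by rewrite openC.
  by move=> /= uxy; apply: uky; rewrite -uxy uxk.
(* interior B contains the fibre over u k, and closure B avoids the one over
   y; so the complement of interior B and closure B are the closed cover. *)
exists (~` (u @` ~` (interior B))), (~` (u @` closure B)); split.
- by rewrite openC; apply: clim; rewrite closedC; exact: open_interior.
- by rewrite openC; apply: clim; exact: closed_closure.
- by move=> [x nBx uxk]; apply: nBx; exact: nB.
- by move=> [x Bx uxy]; exact: BC Bx uxy.
apply/seteqP; split=> // z [[Vz Wz] [x _ uxz]].
apply: Vz; exists x => // Bx; apply: Wz; exists x => //.
by apply: subset_closure; exact: interior_subset.
Qed.

Lemma weak_hausdorff_coincidence (K L Y : topologicalType)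
    (u : continuousType K Y) (v : continuousType L Y) :
  weak_hausdorff Y -> compact_hausdorff K ->
  closed [set kl : K * L | u kl.1 = v kl.2].
Proof.
move=> wY hK; rewrite -openC openE => -[k l] /= ukl.
have [V [W [oV oW Vk Wl VW]]] := weak_hausdorff_separated wY hK ukl.
exists (u @^-1` V, v @^-1` W); first split.
- by apply: (@cts_fun _ _ u); exact: open_nbhs_nbhs.
- by apply: (@cts_fun _ _ v); exact: open_nbhs_nbhs.
move=> [a b] [/= Va Wb] uv.
suff : set0 (u a) by [].
by rewrite -VW; split; [split=> //; rewrite uv|exists a].
Qed.

(** The preimage in L of the image of K is the projection along the compact
    space K of the set of pairs with equal images, and this set is closed as an
    intersection of coincidence sets in the weak Hausdorff spaces [Y t]. *)
Lemma weak_hausdorff_kify (T : topologicalType) (J : Type)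
    (Y : J -> topologicalType) (e : forall t, continuousType T (Y t)) :
  (forall t, weak_hausdorff (Y t)) ->
  (forall x y, (forall t, e t x = e t y) -> x = y) ->
  weak_hausdorff (kify T).
Proof.
move=> wY einj K u hK; rewrite -openC kify_openE => L v hL.
rewrite preimage_setC openC.
have cu : continuous (u : K -> T).
  move=> x; apply: (@continuous_comp K (kify T) T u id); first exact: cts_fun.
  exact: kify_id_continuous.
pose D := \bigcap_t [set kl : K * L | e t (u kl.1) = e t (v kl.2)].
have clD : closed D.
  apply: closed_bigI => t _.
  pose eu : continuousType K (Y t) := e t \o mkcts cu.
  pose ev : continuousType L (Y t) := e t \o v.
  exact: (weak_hausdorff_coincidence (u := eu) (v := ev)).
rewrite [X in closed X](_ : _ = snd @` D); last first.
  apply/seteqP; split=> [l [k _ ukl]|_ [[k l] Dkl <-]].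
    by exists (k, l) => // t _ /=; rewrite ukl.
  by exists k => //; apply: einj => t; exact: Dkl t I.
apply: compact_closed; first by case: hL.
apply: continuous_compact.
  by apply: continuous_subspaceT => x; exact: cvg_snd.
by apply: subclosed_compact clD (compact_hausdorff_prod hK hL).1 _.
Qed.

(** * Mapping spaces *)

Section MapSpace.
Variables (I Y : topologicalType).

Definition map_space : topologicalType :=
  initial_topology
    ((fun g => g) : continuousType I Y -> {compact-open, I -> Y}).

(** The identity, as a map between two types that carry different topologies;
    it exposes the space of all functions as a codomain to unification. *)
Definition map_forget (g : map_space) : {compact-open, I -> Y} := g.

Lemma map_forget_continuous : continuous map_forget.
Proof. exact: initial_continuous. Qed.

Definition map_curry (S : topologicalType) (g : S * I -> Y)
    (cg : continuous g) (s : S) : map_space :=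
  mkcts ((continuous_curry cg).2 s).

Lemma map_curry_continuous (S : topologicalType) (g : S * I -> Y)
  (cg : continuous g) : continuous (map_curry cg).
Proof. exact/continuous_comp_initial/(continuous_curry cg).1. Qed.

Lemma map_uncurry_continuous (S : topologicalType) (u : S -> map_space) :
  compact_hausdorff I -> continuous u ->
  continuous (fun si : S * I => u si.1 si.2).
Proof.
move=> [cI hI] cu.
have -> : (fun si : S * I => u si.1 si.2) =
    uncurry (map_forget \o u).
  by apply/funext => -[].
apply: continuous_uncurry => //.
- move=> x _; rewrite withinET; exists setT; first exact: filterT.
  by split=> //; exact: closedT.
- move=> s.
  exact: (@continuous_comp _ _ _ u map_forget s (cu s)
            (@map_forget_continuous (u s))).
- by move=> s; exact: (@cts_fun _ _ (u s)).
Qed.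

Definition map_eval (t : I) (g : map_space) : Y := g t.

(** A single point is a compact set, so the functions sending it into a given
    open set form a basic open set of the compact-open topology. *)
Lemma map_eval_continuous t : continuous (map_eval t).
Proof.
pose ev (f : {compact-open, I -> Y}) := f t.
suff cev : continuous ev.
  move=> g; exact: (@continuous_comp _ _ _ map_forget ev g
    (@map_forget_continuous g) (cev _)).
apply/continuousP => O oO.
have -> : ev @^-1` O = [set f | f @` [set t] `<=` O].
  by apply/seteqP; split=> f /=; [move=> Oft _ [_ -> <-]|apply; exists t].
by apply: compact_open_open => //; exact: compact_set1.
Qed.

End MapSpace.

Section CGMapSpace.
Variables (I : topologicalType) (Y : cgType).

(** The mapping space of the category of compactly generated spaces. *)
Definition cg_map : Type := kify (map_space I Y).
HB.instance Definition _ := Topological.on cg_map.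

Let cg_map_k : k_space cg_map.
Proof. exact: k_space_kify. Qed.

Let cg_map_wh : weak_hausdorff cg_map.
Proof.
pose e t : continuousType (map_space I Y) Y :=
  mkcts (@map_eval_continuous I Y t).
apply: (weak_hausdorff_kify (e := e)).
  by move=> t; exact: weak_hausdorffP.
by move=> x y xy; apply/continuousEP => t; exact: xy.
Qed.

HB.instance Definition _ :=
  isCompactlyGenerated.Build cg_map cg_map_k cg_map_wh.

End CGMapSpace.

(** * Flows of maps into a flow *)

Lemma connected_discrete_cst (I : topologicalType) (D : discreteTopologicalType)
    (g : I -> D) (s t : I) :
  connected [set: I] -> continuous g -> g s = g t.
Proof.
move=> cI cg.
suff E : g @^-1` [set g t] = [set: I].
  by have : [set: I] s by []; rewrite -E.
apply: cI; first by exists t.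
- exists (g @^-1` [set g t]); last by rewrite setTI.
  exact: (continuousP g).1 cg _ (discrete_open _).
- exists (g @^-1` [set g t]); last by rewrite setTI.
  exact: (continuous_closedP g).1 cg _ (discrete_closed _).
Qed.

Lemma continuous_pair (S T U : topologicalType) (a : S -> T) (b : S -> U) :
  continuous a -> continuous b -> continuous (fun s => (a s, b s)).
Proof. by move=> ca cb s; apply: cvg_pair; [exact: ca|exact: cb]. Qed.

(** The space of composable pairs is k-ified, so pairing is continuous into it
    only from a space where this makes no difference. *)
Lemma concat_continuous (X : flow) (K : topologicalType)
    (a b : K -> pathsp X) (h : forall k, tgt (a k) = src (b k)) :
  compact_hausdorff K -> continuous a -> continuous b ->
  continuous (fun k => concat (cpair (h k))).
Proof.
move=> hK ca cb.
pose c k : set_type [set xy : pathsp X * pathsp X | tgt xy.1 = src xy.2] :=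
  cpair (h k).
have cc : continuous (c : K -> composable src tgt).
  apply: continuous_to_kify => //; apply: continuous_comp_initial.
  exact: continuous_pair.
move=> k.
exact: (@continuous_comp K (composable src tgt) _ c concat k (cc k)
          (@cts_fun _ _ concat _)).
Qed.

Lemma flow_morP (X Y : flow) (u v : flow_mor X Y) :
  u = v <-> mskel u = mskel v /\ forall x, mpath u x = mpath v x.
Proof.
split=> [-> //|]; case: u v => [m p s t c] [m' p' s' t' c'] /=.
move=> [mm' /continuousEP pp'].
by subst m' p'; f_equal; exact: Prop_irrelevance.
Qed.

Section FlowId.
Variable X : flow.

Let flow_id_concat (x y : pathsp X) (h : tgt x = src y)
  (h' : tgt (idfun x) = src (idfun y)) :
  idfun (concat (cpair h)) = concat (cpair h').
Proof. by rewrite /=; congr (concat _); exact: val_inj. Qed.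

Definition flow_id : flow_mor X X :=
  @FlowMor X X idfun idfun (fun=> erefl) (fun=> erefl) flow_id_concat.

End FlowId.

(** For a compact connected Hausdorff space I, this is the cotensor of a flow X
    by I: the flow X^I with the states of X, paths Map(I, PX) and pointwise
    composition. The base point [t0] serves only to read off the source and
    the target of a map I -> PX, which do not vary along I. *)
Section Cotensor.
Variables (I : topologicalType) (t0 : I).
Hypotheses (hI : compact_hausdorff I) (cI : connected [set: I]).

Section Object.
Variable X : flow.

Definition cotensor_paths : cgType := cg_map I (pathsp X).

Let eval_fun (t : I) (g : cotensor_paths) : pathsp X := (g : map_space _ _) t.

Let eval_continuous t : continuous (eval_fun t).
Proof.
move=> g; apply: (@continuous_comp cotensor_paths (map_space I (pathsp X)) _
  (fun g => g) (@map_eval I _ t)); first exact: kify_id_continuous.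
exact: map_eval_continuous.
Qed.

Definition paths_eval (t : I) : continuousType cotensor_paths (pathsp X) :=
  mkcts (@eval_continuous t).

Definition cotensor_src : continuousType cotensor_paths (skel X) :=
  src \o paths_eval t0.
Definition cotensor_tgt : continuousType cotensor_paths (skel X) :=
  tgt \o paths_eval t0.

Lemma src_paths_eval t (g : cotensor_paths) :
  src (paths_eval t g) = cotensor_src g.
Proof.
apply: (@connected_discrete_cst I (skel X) (fun t => src (paths_eval t g)))
  => //.
move=> s; apply: (@continuous_comp _ _ _ (g : continuousType _ _) src);
  exact: cts_fun.
Qed.

Lemma tgt_paths_eval t (g : cotensor_paths) :
  tgt (paths_eval t g) = cotensor_tgt g.
Proof.
apply: (@connected_discrete_cst I (skel X) (fun t => tgt (paths_eval t g)))
  => //.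
move=> s; apply: (@continuous_comp _ _ _ (g : continuousType _ _) tgt);
  exact: cts_fun.
Qed.

Lemma composable_eval (w : composable cotensor_src cotensor_tgt) (t : I) :
  tgt (paths_eval t (set_val w).1) = src (paths_eval t (set_val w).2).
Proof. by rewrite tgt_paths_eval src_paths_eval; exact: set_valP w. Qed.

Lemma cotensor_concat_fun_continuous
  (w : composable cotensor_src cotensor_tgt) :
  continuous (fun t => concat (cpair (composable_eval w t))).
Proof.
apply: concat_continuous => // t.
- exact: (@cts_fun _ _ ((set_val w).1 : continuousType _ _)).
- exact: (@cts_fun _ _ ((set_val w).2 : continuousType _ _)).
Qed.

Definition cotensor_concat_fun (w : composable cotensor_src cotensor_tgt) :
    cotensor_paths :=
  (mkcts (@cotensor_concat_fun_continuous w) : map_space _ _).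

Lemma paths_uncurry_continuous (K : topologicalType) (u : K -> cotensor_paths) :
  continuous u -> continuous (fun kt : K * I => paths_eval kt.2 (u kt.1)).
Proof.
move=> cu; apply: (@map_uncurry_continuous I (pathsp X) K u) => // k.
exact: (@continuous_comp _ cotensor_paths (map_space I (pathsp X)) u id k (cu k)
          (@kify_id_continuous _ _)).
Qed.

(** One direction of the exponential law, with continuity of the uncurried map
    required only after restriction to compact Hausdorff spaces; in this form
    no product with a general k-space has to be analysed. *)
Lemma paths_curry_continuous (S : topologicalType) (g : S -> cotensor_paths) :
  k_space S ->
  (forall (K : topologicalType) (u : continuousType K S),
    compact_hausdorff K ->
    continuous (fun kt : K * I => paths_eval kt.2 (g (u kt.1)))) ->
  continuous g.
Proof.
move=> kS cg; apply: k_space_continuous => // K u hK.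
apply: (@continuous_to_kify K (map_space I (pathsp X))) => //.
have -> : g \o u = map_curry (cg K u hK).
  by apply/funext => k; apply/continuousEP.
exact: map_curry_continuous.
Qed.

Lemma cotensor_concat_continuous : continuous cotensor_concat_fun.
Proof.
apply: paths_curry_continuous; first exact: k_space_kify.
move=> K u hK.
have cu : continuous (fun k => set_val (u k)).
  move=> k; apply: (@continuous_comp _ _ _ u (set_val : composable _ _ -> _)).
    exact: cts_fun.
  apply: (@continuous_comp (composable cotensor_src cotensor_tgt)
    (set_type _) _ id set_val).
    exact: kify_id_continuous.
  exact: initial_continuous.
apply: (@concat_continuous X (K * I)%type
  (fun kt => paths_eval kt.2 (set_val (u kt.1)).1)
  (fun kt => paths_eval kt.2 (set_val (u kt.1)).2)
  (fun kt => composable_eval (u kt.1) kt.2)).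
- exact: compact_hausdorff_prod.
- apply: (@paths_uncurry_continuous K (fun k => (set_val (u k)).1)) => k.
  exact: (@continuous_comp _ _ _ _ fst k (cu k) cvg_fst).
- apply: (@paths_uncurry_continuous K (fun k => (set_val (u k)).2)) => k.
  exact: (@continuous_comp _ _ _ _ snd k (cu k) cvg_snd).
Qed.

Definition cotensor_concat :
    continuousType (composable cotensor_src cotensor_tgt) cotensor_paths :=
  mkcts cotensor_concat_continuous.

Let src_cotensor_concat (x y : cotensor_paths)
  (h : cotensor_tgt x = cotensor_src y) :
  cotensor_src (cotensor_concat (cpair h)) = cotensor_src x.
Proof. exact: src_concat. Qed.

Let tgt_cotensor_concat (x y : cotensor_paths)
  (h : cotensor_tgt x = cotensor_src y) :
  cotensor_tgt (cotensor_concat (cpair h)) = cotensor_tgt y.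
Proof. exact: tgt_concat. Qed.

Let cotensor_concatA (x y z : cotensor_paths)
  (hxy : cotensor_tgt x = cotensor_src y)
  (hyz : cotensor_tgt y = cotensor_src z)
  (hl : cotensor_tgt (cotensor_concat (cpair hxy)) = cotensor_src z)
  (hr : cotensor_tgt x = cotensor_src (cotensor_concat (cpair hyz))) :
  cotensor_concat (cpair hl) = cotensor_concat (cpair hr).
Proof. by apply/continuousEP => t; exact: concatA. Qed.

Definition cotensor : flow :=
  Flow src_cotensor_concat tgt_cotensor_concat cotensor_concatA.

Let eval_concat t (x y : pathsp cotensor) (h : tgt x = src y)
  (h' : tgt (paths_eval t x) = src (paths_eval t y)) :
  paths_eval t (concat (cpair h)) = concat (cpair h').
Proof. by rewrite /=; congr (concat _); exact: val_inj. Qed.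

Definition flow_eval (t : I) : flow_mor cotensor X :=
  @FlowMor cotensor X idfun (paths_eval t)
    (src_paths_eval t) (tgt_paths_eval t) (@eval_concat t).

End Object.
End Cotensor.

(** A homotopy that is a morphism of flows at each time, with a fixed action on
    states, is a morphism into the cotensor. *)
Section FlowCurry.
Variables (I : topologicalType) (t0 : I).
Hypotheses (hI : compact_hausdorff I) (cI : connected [set: I]).
Variables (B X : flow) (m : skel B -> skel X)
  (G : continuousType (kify (I * pathsp B)%type) (pathsp X)).
Hypotheses (G_src : forall t b, src (G (t, b)) = m (src b))
  (G_tgt : forall t b, tgt (G (t, b)) = m (tgt b))
  (G_concat : forall t (x y : pathsp B) (h : tgt x = src y)
     (h' : tgt (G (t, x)) = src (G (t, y))),
     G (t, concat (cpair h)) = concat (cpair h')).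

Let homotopy_continuous (K : topologicalType) (a : K -> I) (b : K -> pathsp B) :
  compact_hausdorff K -> continuous a -> continuous b ->
  continuous (fun k => G (a k, b k)).
Proof.
move=> hK ca cb k.
apply: (@continuous_comp K (kify (I * pathsp B)%type) _
  (fun k => (a k, b k)) G); last exact: cts_fun.
by apply: continuous_to_kify => //; exact: continuous_pair.
Qed.

Let flow_curry_at (b : pathsp B) : continuous (fun t => G (t, b)).
Proof.
by apply: homotopy_continuous => // t; [exact: cvg_id|exact: cvg_cst].
Qed.

Let flow_curry_fun (b : pathsp B) : cotensor_paths I X :=
  (mkcts (@flow_curry_at b) : map_space _ _).

Let flow_curry_continuous : continuous flow_curry_fun.
Proof.
apply: paths_curry_continuous; first exact: k_spaceP.
move=> K u hK; apply: (@homotopy_continuous _ snd (fun kt => u kt.1)).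
- exact: compact_hausdorff_prod.
- by move=> kt; exact: cvg_snd.
- move=> kt.
  exact: (@continuous_comp _ _ _ fst u kt cvg_fst (@cts_fun _ _ u _)).
Qed.

Let flow_curry_path : continuousType (pathsp B) (cotensor_paths I X) :=
  mkcts flow_curry_continuous.

Let flow_curry_src (b : pathsp B) :
  @src (cotensor t0 hI cI X) (flow_curry_path b) = m (src b).
Proof. exact: G_src. Qed.

Let flow_curry_tgt (b : pathsp B) :
  @tgt (cotensor t0 hI cI X) (flow_curry_path b) = m (tgt b).
Proof. exact: G_tgt. Qed.

Let flow_curry_concat (x y : pathsp B) (h : tgt x = src y)
  (h' : @tgt (cotensor t0 hI cI X) (flow_curry_path x) =
        @src (cotensor t0 hI cI X) (flow_curry_path y)) :
  flow_curry_path (concat (cpair h)) =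
  @concat (cotensor t0 hI cI X) (cpair h').
Proof. by apply/continuousEP => t; exact: G_concat. Qed.

Lemma flow_curry_exists : exists u : flow_mor B (cotensor t0 hI cI X),
  mskel u = m /\ forall t b, paths_eval X t (mpath u b) = G (t, b).
Proof.
by exists (FlowMor flow_curry_src flow_curry_tgt flow_curry_concat).
Qed.

End FlowCurry.

(** * The unit interval and relative homotopies *)

Section Interval.
Variable R : realType.

Let clamp_subproof (x : R) :
  Num.max 0 (Num.min 1 x) \in (`[0 : R, 1]%classic : set R).
Proof.
by rewrite inE /= in_itv /= le_max lexx /= ge_max ler01 ge_min lexx.
Qed.

(** The retraction of the real line onto the unit interval. It transfers
    compactness and connectedness from the segment, and turns real formulas
    into reparametrizations of the interval. *)
Definition clamp (x : R) : unitI R :=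
  exist _ (Num.max 0 (Num.min 1 x)) (clamp_subproof x).

Lemma clamp_continuous : continuous clamp.
Proof.
apply: continuous_comp_initial.
apply: max_fun_continuous; first by move=> x; exact: cvg_cst.
by apply: min_fun_continuous => x; [exact: cvg_cst|exact: cvg_id].
Qed.

Lemma unitI_ge0 (s : unitI R) : 0 <= set_val s.
Proof. by have := set_valP s; rewrite /= in_itv /= => /andP[]. Qed.

Lemma unitI_le1 (s : unitI R) : set_val s <= 1.
Proof. by have := set_valP s; rewrite /= in_itv /= => /andP[]. Qed.

Lemma clampK : cancel set_val clamp.
Proof.
move=> s; apply: val_inj; rewrite /= (min_idPr (unitI_le1 s)).
exact: (max_idPr (unitI_ge0 s)).
Qed.

Lemma clamp_le0 x : x <= 0 -> clamp x = unitI0.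
Proof.
move=> x0; apply: val_inj => /=.
by rewrite (min_idPr (le_trans x0 ler01)) (max_idPl x0).
Qed.

Lemma clamp_ge1 x : 1 <= x -> clamp x = unitI1.
Proof.
by move=> x1; apply: val_inj => /=; rewrite (min_idPl x1) (max_idPr ler01).
Qed.

Lemma clamp_image : clamp @` `[0, 1]%classic = [set: unitI R].
Proof.
apply/seteqP; split=> // s _; exists (set_val s); last exact: clampK.
exact: set_valP s.
Qed.

Lemma compact_hausdorff_unitI : compact_hausdorff (unitI R).
Proof.
split.
  rewrite -clamp_image; apply: continuous_compact; last exact: segment_compact.
  exact/continuous_subspaceT/clamp_continuous.
move=> s t st; apply: val_inj.
by apply: cluster_continuous st => //; exact: initial_continuous.
Qed.

Lemma connected_unitI : connected [set: unitI R].
Proof.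
rewrite -clamp_image; apply: connected_continuous_connected.
  exact: segment_connected.
exact/continuous_subspaceT/clamp_continuous.
Qed.

Section RelHomotopy.
Variables (T Y : topologicalType) (B : set T) (y : Y).

(** With [B] the boundary of the cube this is homotopy of based n-loops; with
    [B] empty, between constant maps, it is connection by a path. One proof of
    symmetry and transitivity thus serves both. *)
Definition homotopic_rel (a b : T -> Y) : Prop :=
  exists H : unitI R * T -> Y,
    [/\ continuous H, forall t, H (unitI0, t) = a t,
        forall t, H (unitI1, t) = b t & forall s t, B t -> H (s, t) = y].

Lemma homotopic_rel_refl (a : T -> Y) :
  continuous a -> (forall t, B t -> a t = y) -> homotopic_rel a a.
Proof.
move=> ca aB; exists (a \o snd); split=> //.
by move=> st; exact: (@continuous_comp _ _ _ snd a st cvg_snd (ca _)).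
Qed.

Let reparam (u : R -> R) : unitI R * T -> unitI R * T :=
  fun st => (clamp (u (set_val st.1)), st.2).

Let reparam_continuous (u : R -> R) : continuous u -> continuous (reparam u).
Proof.
move=> cu; apply: continuous_pair; last by move=> ?; exact: cvg_snd.
move=> st; apply: (@continuous_comp _ _ _
  (fun st : unitI R * T => u (set_val st.1))); last exact: clamp_continuous.
apply: (@continuous_comp _ _ _ (fun st : unitI R * T => set_val st.1) u);
  last exact: cu.
exact: (@continuous_comp _ _ _ fst (set_val : unitI R -> R) st cvg_fst
  (@initial_continuous _ _ _ _)).
Qed.

Lemma homotopic_rel_sym (a b : T -> Y) :
  homotopic_rel a b -> homotopic_rel b a.
Proof.
move=> [H [cH H0 H1 HB]]; exists (H \o reparam (fun x => 1 - x)); split.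
- move=> st; apply: continuous_comp; last exact: cH.
  apply: reparam_continuous => x; apply: cvgB; [exact: cvg_cst|exact: cvg_id].
- by move=> t; rewrite /reparam /= subr0 clamp_ge1.
- by move=> t; rewrite /reparam /= subrr clamp_le0.
- by move=> s t Bt; exact: HB.
Qed.

(** Both halves are reparametrized on the whole of I thanks to [clamp], and are
    glued along the closed sets 2s <= 1 and 1 <= 2s, on whose intersection
    they are both [b]. *)
Lemma homotopic_rel_trans (b a c : T -> Y) :
  homotopic_rel a b -> homotopic_rel b c -> homotopic_rel a c.
Proof.
move=> [F [cF F0 F1 FB]] [G [cG G0 G1 GB]].
pose F' := F \o reparam (fun x => x *+ 2).
pose G' := G \o reparam (fun x => x *+ 2 - 1).
have cF' : continuous F'.
  move=> st; apply: continuous_comp; last exact: cF.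
  by apply: reparam_continuous => x; apply: cvgMn; exact: cvg_id.
have cG' : continuous G'.
  move=> st; apply: continuous_comp; last exact: cG.
  apply: reparam_continuous => x.
  by apply: cvgB; [apply: cvgMn; exact: cvg_id|exact: cvg_cst].
pose H (st : unitI R * T) := if set_val st.1 *+ 2 <= 1 then F' st else G' st.
have cdbl : continuous (fun st : unitI R * T => set_val st.1 *+ 2).
  move=> st; apply: cvgMn.
  exact: (@continuous_comp _ _ _ fst (set_val : unitI R -> R) st cvg_fst
    (@initial_continuous _ _ _ _)).
have HF st : set_val st.1 *+ 2 <= 1 -> H st = F' st by rewrite /H => ->.
have HG st : 1 <= set_val st.1 *+ 2 -> H st = G' st.
  rewrite /H; case: ifP => // s1 s1'.
  have s_eq : set_val st.1 *+ 2 = 1 by apply/eqP; rewrite eq_le s1 s1'.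
  by rewrite /F' /G' /reparam /= s_eq subrr clamp_ge1 // clamp_le0 // F1 G0.
exists H; split.
- apply/continuous_subspace_setT.
  have -> : [set: unitI R * T] = [set st | set_val st.1 *+ 2 <= 1] `|`
      [set st | 1 <= set_val st.1 *+ 2].
    by apply/seteqP; split=> // st _ /=; have [] := leP (set_val st.1 *+ 2) 1;
      [left|move=> /ltW; right].
  apply: withinU_continuous.
  + exact: (continuous_closedP _).1 cdbl _ (@closed_le R 1).
  + exact: (continuous_closedP _).1 cdbl _ (@closed_ge R 1).
  + apply: (@subspace_eq_continuous _ _ _ F').
      by move=> st; rewrite inE /= => /HF.
    exact: continuous_subspaceT.
  + apply: (@subspace_eq_continuous _ _ _ G').
      by move=> st; rewrite inE /= => /HG.
    exact: continuous_subspaceT.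
- move=> t; rewrite HF /F' /reparam /= mul0rn ?ler01 //.
  by rewrite clamp_le0.
- move=> t; rewrite HG /G' /reparam /= mulr2n ?lerDl ?ler01 //.
  by rewrite addrK clamp_ge1.
- by move=> s t Bt; rewrite /H; case: ifP => _; [exact: FB|exact: GB].
Qed.

End RelHomotopy.

End Interval.

(** * Strong deformation retracts are weak homotopy equivalences *)

(** The common form of the statements on path components and on homotopy
    groups: [G] is a set of representatives, [cls a] the class of [a], and the
    map induced on classes is a union over representatives. *)
Lemma quotient_map_bij (E E' : Type) (G : set E) (G' : set E')
    (cls : E -> set E) (cls' : E' -> set E') (F : E -> E') :
  (forall a, G a -> cls a a) ->
  (forall a b, G a -> cls a b -> G b /\ cls a = cls b) ->
  (forall a, G' a -> cls' a a) ->
  (forall a b, G' a -> cls' a b -> G' b /\ cls' a = cls' b) ->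
  (forall a, G a -> G' (F a)) ->
  (forall a b, G a -> cls a b -> cls' (F a) (F b)) ->
  (forall a b, G a -> G b -> cls' (F a) (F b) -> cls a b) ->
  (forall b, G' b -> exists2 a, G a & cls' (F a) b) ->
  set_bij (cls @` G) (cls' @` G') (fun C => \bigcup_(a in C) cls' (F a)).
Proof.
move=> refl eqv refl' eqv' FG Fcls Finj Fsurj.
have FE a : G a -> \bigcup_(b in cls a) cls' (F b) = cls' (F a).
  move=> Ga; apply/seteqP; split=> [y [b ab Fby]|y Fay]; last first.
    by exists a => //; exact: refl.
  by rewrite (eqv' _ _ (FG _ Ga) (Fcls _ _ Ga ab)).2.
split.
- by move=> _ [a Ga <-]; rewrite FE //; exists (F a) => //; exact: FG.
- move=> _ _ /set_mem[a Ga <-] /set_mem[b Gb <-]; rewrite !FE // => ab.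
  apply: (eqv _ _ Ga _).2; apply: Finj => //.
  by rewrite ab; exact: refl' (FG _ Gb).
- move=> _ [b G'b <-]; have [a Ga ab] := Fsurj _ G'b.
  exists (cls a); first by exists a.
  by rewrite FE // (eqv' _ _ (FG _ Ga) ab).2.
Qed.

Section Pi.
Variable R : realType.

Lemma homotopic_rel_comp (T Y Z : topologicalType) (B : set T) (y : Y)
    (g : Y -> Z) (a b : T -> Y) : continuous g ->
  homotopic_rel R B y a b -> homotopic_rel R B (g y) (g \o a) (g \o b).
Proof.
move=> cg [H [cH H0 H1 HB]]; exists (g \o H); split.
- by move=> st; apply: continuous_comp; [exact: cH|exact: cg].
- by move=> t /=; rewrite H0.
- by move=> t /=; rewrite H1.
- by move=> s t Bt /=; rewrite HB.
Qed.

(** Any nonempty space can serve as the source of the constant maps; here it is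
    the two-point space. *)
Lemma pi0_classP (X : topologicalType) (x y : X) :
  pi0_class R x y <-> homotopic_rel R (set0 : set bool) x (cst x) (cst y).
Proof.
split=> [[c [c0 c1]]|[H [cH H0 H1 _]]].
  exists (c \o fst); split=> // st.
  exact: (@continuous_comp _ _ _ fst c st cvg_fst (@cts_fun _ _ c _)).
have cpair_true : continuous (fun s : unitI R => (s, true)).
  apply: continuous_pair => s; first exact: cvg_id.
  exact: (@cts_fun _ _ (cst true : _ -> bool) s).
have cHt : continuous (fun s : unitI R => H (s, true)).
  by move=> s; exact: (@continuous_comp _ _ _ _ H s (cpair_true s) (cH _)).
by exists (mkcts cHt); split; [exact: H0|exact: H1].
Qed.

Lemma homotopic_rel_set0 (T Y : topologicalType) (y y' : Y) (a b : T -> Y) :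
  homotopic_rel R set0 y a b -> homotopic_rel R set0 y' a b.
Proof. by move=> [H [? ? ? _]]; exists H; split. Qed.

Lemma pi0_class_refl (X : topologicalType) (x : X) : pi0_class R x x.
Proof.
by apply/pi0_classP; apply: homotopic_rel_refl => // ?; exact: cvg_cst.
Qed.

Lemma pi0_class_eq (X : topologicalType) (x y : X) :
  pi0_class R x y -> pi0_class R x = pi0_class R y.
Proof.
move=> /pi0_classP xy; apply/seteqP; split=> z /pi0_classP xz; apply/pi0_classP.
  apply: homotopic_rel_trans (homotopic_rel_set0 _ xz).
  exact: homotopic_rel_set0 (homotopic_rel_sym xy).
exact: homotopic_rel_trans xy (homotopic_rel_set0 _ xz).
Qed.

Lemma gloop_homotopicP (n : nat) (X : topologicalType) (x : X)
    (a b : continuousType (cube R n) X) :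
  gloop_homotopic x a b <-> homotopic_rel R (@cube_boundary R n) x a b.
Proof.
split=> [[H [H0 H1 HB]]|[H [cH H0 H1 HB]]].
  by exists H; split=> //; exact: cts_fun.
by exists (mkcts cH).
Qed.

Lemma pi_class_refl (n : nat) (X : topologicalType) (x : X)
    (a : continuousType (cube R n) X) : gloop x a -> pi_class x a a.
Proof.
move=> xa; split=> //; apply/gloop_homotopicP.
by apply: homotopic_rel_refl => //; exact: cts_fun.
Qed.

Lemma pi_class_eq (n : nat) (X : topologicalType) (x : X)
    (a b : continuousType (cube R n) X) :
  pi_class x a b -> pi_class x a = pi_class x b.
Proof.
move=> [_ /gloop_homotopicP ab].
apply/seteqP; split=> c [xc /gloop_homotopicP ac]; split=> //.
  apply/gloop_homotopicP.
  exact: homotopic_rel_trans (homotopic_rel_sym ab) ac.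
by apply/gloop_homotopicP; apply: homotopic_rel_trans ab ac.
Qed.

(** Injectivity holds because [r] undoes [f]. For surjectivity, H deforms a map
    b into f o r o b, and it keeps the boundary of the cube at the base point
    because that point lies in the image of [f], where H is stationary. *)
Lemma strong_deformation_retract_weak_equivalence (X Y : topologicalType)
    (f : continuousType X Y) (r : continuousType Y X)
    (H : Y -> map_space (unitI R) Y) : continuous H ->
  cancel f r -> (forall y, H y unitI0 = y) ->
  (forall y, H y unitI1 = f (r y)) -> (forall x t, H (f x) t = f x) ->
  weak_homotopy_equivalence R f.
Proof.
move=> cH fK H0 H1 Hf.
have retract (T : topologicalType) (B : set T) (b : T -> Y) (x : X) :
    continuous b -> (forall t, B t -> b t = f x) ->
    homotopic_rel R B (f x) (f \o r \o b) b.
  move=> cb bB; apply: homotopic_rel_sym.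
  exists (fun st => H (b st.2) st.1); split=> //=.
    have cHb : continuous (H \o b).
      by move=> t; apply: continuous_comp; [exact: cb|exact: cH].
    have cu := map_uncurry_continuous (compact_hausdorff_unitI R) cHb.
    have cswap : continuous (fun st : unitI R * T => (st.2, st.1)).
      by apply: continuous_pair => st; [exact: cvg_snd|exact: cvg_fst].
    by move=> st; exact: (@continuous_comp _ _ _ _ _ st (cswap st) (cu _)).
  by move=> s t Bt; rewrite bB.
split.
- apply: quotient_map_bij => //.
  + by move=> x _; exact: pi0_class_refl.
  + by move=> x y _ xy; split=> //; exact: pi0_class_eq.
  + by move=> x _; exact: pi0_class_refl.
  + by move=> x y _ xy; split=> //; exact: pi0_class_eq.
  + move=> x y _ /pi0_classP xy; apply/pi0_classP.
    exact: homotopic_rel_comp (@cts_fun _ _ f) xy.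
  + move=> x y _ _ /pi0_classP xy; apply/pi0_classP.
    have := homotopic_rel_comp (@cts_fun _ _ r) xy.
    rewrite fK.
    have cE z : r \o cst (f z) = cst z :> (bool -> X).
      by apply/funext => ?; exact: fK.
    by rewrite !cE.
  + move=> y _; exists (r y) => //; apply/pi0_classP.
    apply: (homotopic_rel_set0 (y := f (r y))).
    by apply: (retract bool set0 (cst y)) => // ?; exact: cvg_cst.
- move=> n x _.
  apply: (@quotient_map_bij _ _ (@gloop R n X x) (@gloop R n Y (f x))
    (@pi_class R n X x) (@pi_class R n Y (f x)) (fun a => f \o a)).
  + exact: pi_class_refl.
  + by move=> a b _ ab; split; [case: ab|exact: pi_class_eq].
  + exact: pi_class_refl.
  + by move=> a b _ ab; split; [case: ab|exact: pi_class_eq].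
  + by move=> a xa t tB /=; rewrite xa.
  + move=> a b xa [xb /gloop_homotopicP ab]; split.
      by move=> t tB /=; rewrite xb.
    by apply/gloop_homotopicP; exact: homotopic_rel_comp (@cts_fun _ _ f) ab.
  + move=> a b xa xb [_ /gloop_homotopicP ab]; split=> //.
    apply/gloop_homotopicP.
    have := homotopic_rel_comp (@cts_fun _ _ r) ab; rewrite fK.
    have cE (c : continuousType (cube R n) X) : r \o (f \o c) = c :> (_ -> _).
      by apply/funext => t; exact: fK.
    by rewrite !cE.
  + move=> b xb; exists (r \o b).
      by move=> t tB /=; rewrite xb.
    split=> //; apply/gloop_homotopicP.
    by apply: retract xb; exact: cts_fun.
Qed.

End Pi.

(** * Pushing the deformation along the pushout square *)

Lemma pushout_ext (B A C X : flow) (phi : flow_mor B A) (g : flow_mor B C)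
    (f : flow_mor A X) (psi : flow_mor C X) (Z : flow) (h k : flow_mor X Z) :
  is_pushout phi g f psi ->
  flow_comp h f = flow_comp k f -> flow_comp h psi = flow_comp k psi -> h = k.
Proof.
move=> [/flow_morP[comms commp] univ] hkf hkpsi.
have [|l [_ luniq]] := univ Z (flow_comp k f) (flow_comp k psi).
  apply/flow_morP; split=> [|x].
    exact: (congr1 (fun m => mskel k \o m) comms).
  exact: (congr1 (mpath k) (commp x)).
by rewrite -(luniq h) // -(luniq k).
Qed.

Section PushoutDeformation.
Variables (I : topologicalType) (t0 t1 : I).
Hypotheses (hI : compact_hausdorff I) (cI : connected [set: I]).
Variables (P Q : cgType) (i : continuousType P Q) (r : continuousType Q P)
  (K : continuousType (kify (I * Q)%type) Q).
Hypotheses (rK : forall p, r (i p) = p) (K0 : forall q, K (t0, q) = q)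
  (K1 : forall q, K (t1, q) = i (r q)) (Ki : forall t p, K (t, i p) = i p).
Variables (A X : flow) (phi : flow_mor (Glob P) A) (f : flow_mor A X)
  (psi : flow_mor (Glob Q) X).
Hypothesis po : is_pushout phi (Glob_map i) f psi.

Let XI : flow := cotensor t0 hI cI X.

(** Stationarity of K on P makes the constant homotopy at [f] and [psi o K]
    agree on Glob(P), so they induce [H]; the endpoints of [H] are identified by
    comparing morphisms out of X on A and on Glob(Q). *)
Lemma pushout_strong_deformation_retract :
  exists (h : flow_mor X A) (H : flow_mor X XI),
    [/\ flow_comp h f = flow_id A,
        flow_comp (flow_eval t0 hI cI X t0) H = flow_id X,
        flow_comp (flow_eval t0 hI cI X t1) H = flow_comp f h &
        forall t, flow_comp (flow_comp (flow_eval t0 hI cI X t) H) f = f].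
Proof.
have [/flow_morP[comms commp] univ] := po.
have [|h [[hf hpsi] _]] := univ A (flow_id A) (flow_comp phi (Glob_map r)).
  by apply/flow_morP; split=> // p; rewrite /= rK.
have [hfs hfp] := (flow_morP _ _).1 hf.
have [hpsis hpsip] := (flow_morP _ _).1 hpsi.
have csnd : continuous (snd : kify (I * pathsp A)%type -> pathsp A).
  move=> w; apply: (@continuous_comp (kify (I * pathsp A)%type)
    (I * pathsp A)%type _ id snd); first exact: kify_id_continuous.
  exact: cvg_snd.
have [|||u [us up]] := @flow_curry_exists _ t0 hI cI A X (mskel f)
    (mpath f \o mkcts csnd).
- by move=> t a; exact: mor_src.
- by move=> t a; exact: mor_tgt.
- by move=> t x y xy xy'; exact: mor_concat.
have [|||v [vs vp]] := @flow_curry_exists _ t0 hI cI (Glob Q) X (mskel psi)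
    (mpath psi \o K).
- by move=> t q; exact: mor_src.
- by move=> t q; exact: mor_tgt.
- by move=> t x y xy xy'; exact: mor_concat.
have [|H [[Hf Hpsi] _]] := univ XI u v.
  apply/flow_morP; split=> [|p] /=; first by rewrite us vs.
  apply/continuousEP => t; apply: (etrans (up t (mpath phi p))).
  apply: (etrans _ (esym (vp t (i p)))); rewrite /= Ki.
  exact: commp.
have [Hfs Hfp] := (flow_morP _ _).1 Hf.
have [Hpsis Hpsip] := (flow_morP _ _).1 Hpsi.
have evf t a : paths_eval X t (mpath H (mpath f a)) = mpath f a.
  by apply: (etrans (congr1 (paths_eval X t) (Hfp a))); exact: up.
have evpsi t q :
    paths_eval X t (mpath H (mpath psi q)) = mpath psi (K (t, q)).
  by apply: (etrans (congr1 (paths_eval X t) (Hpsip q))); exact: vp.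
rewrite us in Hfs; rewrite vs in Hpsis.
exists h, H; split.
- exact: hf.
- apply: (pushout_ext po); apply/flow_morP; split.
  + exact: Hfs.
  + exact: evf.
  + exact: Hpsis.
  + by move=> q; apply: (etrans (evpsi _ q)); rewrite K0.
- apply: (pushout_ext po); apply/flow_morP; split.
  + exact: (etrans Hfs (esym (congr1 (fun m => mskel f \o m) hfs))).
  + by move=> a; exact: (etrans (evf _ a) (esym (congr1 (mpath f) (hfp a)))).
  + apply: (etrans Hpsis).
    exact: (etrans (esym comms) (esym (congr1 (fun m => mskel f \o m) hpsis))).
  + move=> q; apply: (etrans (evpsi _ q)); rewrite K1.
    apply: (etrans (esym (commp (r q)))).
    exact: (esym (congr1 (mpath f) (hpsip q))).
- by move=> t; apply/flow_morP; split; [exact: Hfs|exact: evf].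
Qed.

End PushoutDeformation.

Theorem theorem15p2 (R : realType) (P Q : cgType) (i : continuousType P Q)
    (A X : flow) (phi : flow_mor (Glob P) A) (f : flow_mor A X)
    (psi : flow_mor (Glob Q) X) :
  deformation_retract_inclusion R i ->
  is_pushout phi (Glob_map i) f psi ->
  weak_homotopy_equivalence R (mpath f).
Proof.
move=> [r [K [rK K0 K1 Ki]]] po.
have [h [H [/flow_morP[_ hf] /flow_morP[_ H0] /flow_morP[_ H1] Hf]]] :=
  pushout_strong_deformation_retract (@compact_hausdorff_unitI R)
    (@connected_unitI R) rK K0 K1 Ki po.
apply: (@strong_deformation_retract_weak_equivalence R _ _ (mpath f) (mpath h)
  (fun x => mpath H x)).
- move=> x.
  apply: (@continuous_comp _ (cotensor_paths _ _) (map_space _ _) (mpath H) id).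
    exact: cts_fun.
  exact: kify_id_continuous.
- exact: hf.
- exact: H0.
- exact: H1.
- by move=> a t; have [_] := (flow_morP _ _).1 (Hf t); exact.
Qed.
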